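(* Let $C$ be a tamely laced generalized Cartan matrix and let $R$ be any commutative ring over $\mathbb{Z}$ with identity element; $R^{\times}$ denotes the group of invertible elements of $R$. (1) For any family $T=\{T^{(a)}_m(u)\in R^{\times}\mid a\in I, m\in\mathbb{N}, u\in U\}$ satisfying the unrestricted T-system $\mathbb{T}(C)$ in $R$, define a family $Y=\{Y^{(a)}_m(u)\in R^{\times}\mid a\in I, m\in\mathbb{N}, u\in U\}$ by $$Y^{(a)}_m(u)=\frac{M^{(a)}_m(u)}{T^{(a)}_{m-1}(u)T^{(a)}_{m+1}(u)},\qquad (\ast)$$ where $T^{(a)}_0(u)=1$. Then $$1+Y^{(a)}_m(u)=\frac{T^{(a)}_m\left(u-\frac{d_a}{t}\right)T^{(a)}_m\left(u+\frac{d_a}{t}\right)}{T^{(a)}_{m-1}(u)T^{(a)}_{m+1}(u)},\qquad 1+Y^{(a)}_m(u)^{-1}=\frac{T^{(a)}_m\left(u-\frac{d_a}{t}\right)T^{(a)}_m\left(u+\frac{d_a}{t}\right)}{M^{(a)}_m(u)}.$$ Furthermore, $Y$ satisfies the unrestricted Y-system $\mathbb{Y}(C)$ in $R$. (2) Conversely, for any family $Y=\{Y^{(a)}_m(u)\in R^{\times}\mid a\in I,m\in\mathbb{N},u\in U\}$ satisfying $\mathbb{Y}(C)$ with $1+Y^{(a)}_m(u)^{\pm1}\in R^{\times}$, there is a (not unique) family $T=\{T^{(a)}_m(u)\in R^{\times}\mid a\in I,m\in\mathbb{N},u\in U\}$ satisfying $\mathbb{T}(C)$ such that $Y^{(a)}_m(u)$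 is given by $(\ast)$.
   Context: $\mathbb{N}=\mathbb{Z}_{>0}$. A generalized Cartan matrix is an integer matrix $C=(C_{ij})_{i,j\in I}$, $I=\{1,\dots,r\}$, with $C_{ii}=2$, $C_{ij}\le 0$ for $i\ne j$, and $C_{ij}=0$ iff $C_{ji}=0$. It is symmetrizable if there is $D=\mathrm{diag}(d_1,\dots,d_r)$, $d_i\in\mathbb{N}$, with $DC$ symmetric; $D$ is fixed, with no common divisor of $d_1,\dots,d_r$ other than 1. $C$ is tamely laced if it is symmetrizable and: if $C_{ij}<-1$, then $d_i=-C_{ji}=1$. Put $t=\mathrm{lcm}(d_1,\dots,d_r)$, and write $a\sim b$ if $C_{ab}<0$. $U$ is any one of: $\frac1t\mathbb{Z}$; the complex plane $\mathbb{C}$; or the cylinder $\mathbb{C}_\xi=\mathbb{C}/(2\pi\sqrt{-1}/\xi)\mathbb{Z}$ for some $\xi\in\mathbb{C}\setminus 2\pi\sqrt{-1}\,\mathbb{Q}$. Unrestricted T-system $\mathbb{T}(C)$: the relations, for all $a\in I$, $m\in\mathbb{N}$, $u\in U$, $$T^{(a)}_m\left(u-\tfrac{d_a}{t}\right)T^{(a)}_m\left(u+\tfrac{d_a}{t}\right)=T^{(a)}_{m-1}(u)T^{(a)}_{m+1}(u)+M^{(a)}_m(u),$$ where $T^{(a)}_0(u)=1$ on the right-hand sides, and $$M^{(a)}_m(u)=\prod_{b:b\sim a}T^{(b)}_{\frac{d_a}{d_b}m}(u)\ \text{ if } d_a>1,\qquad M^{(a)}_m(u)=\prod_{b:b\sim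 a}S^{(b)}_m(u)\ \text{ if } d_a=1,$$ $$S^{(b)}_m(u)=\prod_{k=1}^{d_b}T^{(b)}_{1+E\left[\frac{m-k}{d_b}\right]}\left(u+\tfrac1t\left(2k-1-m+E\left[\tfrac{m-k}{d_b}\right]d_b\right)\right),$$ with $E[x]$ the largest integer not exceeding $x\in\mathbb{Q}$. Unrestricted Y-system $\mathbb{Y}(C)$: the relations, for all $a\in I$, $m\in\mathbb{N}$, $u\in U$, $$Y^{(a)}_m\left(u-\tfrac{d_a}{t}\right)Y^{(a)}_m\left(u+\tfrac{d_a}{t}\right)=\frac{N^{(a)}_m(u)}{(1+Y^{(a)}_{m-1}(u)^{-1})(1+Y^{(a)}_{m+1}(u)^{-1})},$$ where $Y^{(a)}_0(u)^{-1}=0$ on the right-hand sides, $N^{(a)}_m(u)=\prod_{b:b\sim a}Z^{(b)}_{\frac{d_a}{d_b},m}(u)$ if $d_a>1$, and $N^{(a)}_m(u)=\prod_{b:b\sim a}\left(1+Y^{(b)}_{\frac{m}{d_b}}(u)\right)$ if $d_a=1$, with $Y^{(b)}_{\frac{m}{d_b}}(u)=0$ if $\frac{m}{d_b}\notin\mathbb{N}$. Here for $p\in\mathbb{N}$ $$Z^{(b)}_{p,m}(u)=\prod_{j=-p+1}^{p-1}\left\{\prod_{k=1}^{p-|j|}\left(1+Y^{(b)}_{pm+j}\left(u+\tfrac1t(p-|j|+1-2k)\right)\right)\right\}.$$ (For $C$ tamely laced, $a\sim b$ and $d_a>1$ imply $\frac{d_a}{d_b}\in\{1,d_a\}$.)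 *)

(* Defs.v *)
From HB Require Import structures.
From mathcomp Require Import all_boot all_order all_algebra.
From mathcomp Require Import complex.
From mathcomp Require Import boolp reals trigo.

Set Implicit Arguments.
Unset Strict Implicit.
Unset Printing Implicit Defensive.

Import Order.TTheory GRing.Theory Num.Theory.

Local Open Scope ring_scope.

Definition gen_cartan_matrix (r : nat) (C : 'M[int]_r) : Prop :=
  [/\ forall a, C a a = 2,
      forall a b, a != b -> C a b <= 0
    & forall a b, C a b = 0 <-> C b a = 0].

(* [d] is the diagonal of the matrix D fixed together with C. *)
Definition symmetrizer (r : nat) (C : 'M[int]_r) (d : 'I_r -> nat) : Prop :=
  let D : 'M[int]_r := diag_mx (\row_a (d a)%:Z) in
  [/\ forall a, (0 < d a)%N,
      (D *m C)^T = D *m C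
    & forall k : nat, (forall a, (k %| d a)%N) -> k = 1%N].

Definition tamely_laced (r : nat) (C : 'M[int]_r) (d : 'I_r -> nat) : Prop :=
  symmetrizer C d /\
  forall a b, C a b < -1 -> d a = 1%N /\ - C b a = 1.

Definition lcm_sym (r : nat) (d : 'I_r -> nat) : nat := \big[lcmn/1%N]_a d a.

Definition lattice_pred (t : nat) : pred rat :=
  fun x => t%:R * x \is a Num.int.

Lemma lattice_zmod_closed (t : nat) : zmod_closed (lattice_pred t).
Proof.
split=> [|x y]; rewrite /lattice_pred !unfold_in /= ?mulr0 ?rpred0 //.
by rewrite mulrBr => tx ty; apply: rpredB.
Qed.

HB.instance Definition _ (t : nat) :=
  GRing.isZmodClosed.Build rat (lattice_pred t) (lattice_zmod_closed t).

Record lattice (t : nat) : Type :=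
  Lattice { lattice_val :> rat; _ : lattice_val \in lattice_pred t }.

HB.instance Definition _ (t : nat) := [isSub for @lattice_val t].
HB.instance Definition _ (t : nat) := [Choice of lattice t by <:].
HB.instance Definition _ (t : nat) :=
  [SubChoice_isSubZmodule of lattice t by <:].

Lemma lattice_step_subproof (t : nat) : t%:R^-1 \in lattice_pred t.
Proof.
rewrite unfold_in /lattice_pred.
have [->|t0] := eqVneq (t%:R : rat) 0; first by rewrite mul0r rpred0.
by rewrite mulfV // rpred1.
Qed.

Definition two_pi_i (K : realType) : K[i] := Complex 0 (2 * pi).

Definition period_pred (K : realType) (xi : K[i]) : pred K[i] :=
  fun z => `[< exists k : int, z = two_pi_i K / xi *~ k >].

Lemma period_zmod_closed (K : realType) (xi : K[i]) :
  zmod_closed (period_pred xi).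
Proof.
split=> [|x y]; rewrite /period_pred !unfold_in /=; first by apply/asboolP; exists 0.
move=> /asboolP[j ->] /asboolP[k ->]; apply/asboolP; exists (j - k).
by rewrite mulrzBr.
Qed.

HB.instance Definition _ (K : realType) (xi : K[i]) :=
  GRing.isZmodClosed.Build K[i] (period_pred xi) (period_zmod_closed xi).

Definition cylinder (K : realType) (xi : K[i]) : zmodType :=
  Quotient.quot (GRing.ZmodClosed.clone K[i] (period_pred xi) _).

Inductive domain_kind (K : realType) : Type :=
| LatticeDomain
| PlaneDomain
| CylinderDomain (xi : K[i]) of
    ~ (exists q : rat, xi = two_pi_i K * (ratr q)).

Arguments LatticeDomain {K}.
Arguments PlaneDomain {K}.

Definition domain (K : realType) (t : nat) (k : domain_kind K) : zmodType :=
  match k with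
  | LatticeDomain => lattice t
  | PlaneDomain => K[i]
  | CylinderDomain xi _ => cylinder xi
  end.

(* The element 1/t of U; every shift in the T- and Y-systems is an integer
   multiple of it. *)
Definition step (K : realType) (t : nat) (k : domain_kind K) : domain t k :=
  match k return domain t k with
  | LatticeDomain => Lattice (lattice_step_subproof t)
  | PlaneDomain => t%:R^-1
  | CylinderDomain xi _ => \pi_(cylinder xi)%qT (t%:R^-1)
  end.

(* A family indexed by a, m >= 1, u is a total function in m : nat whose value
   at m = 0 is never used: [T0] and [Yinv0] implement the conventions
   T_0(u) = 1 and Y_0(u)^-1 = 0.  The parameter [h : U] stands for 1/t. *)

Section Systems.

Context (r : nat) (C : 'M[int]_r) (d : 'I_r -> nat).
Context (U : zmodType) (h : U) (R : comUnitRingType).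

Implicit Types (T Y : 'I_r -> nat -> U -> R) (a b : 'I_r) (m p : nat) (u : U).

Definition unit_family T : Prop :=
  forall a m u, (0 < m)%N -> T a m u \is a GRing.unit.

Definition T0 T a m u : R := if m is 0 then 1 else T a m u.

Definition Yinv0 Y a m u : R := if m is 0 then 0 else (Y a m u)^-1.

(* E may be -1, but 1 + E >= 0 since k <= d_b; intdiv's
   [%/] by a positive integer is the floor. *)
Definition Sfac T b m u : R :=
  \prod_(1 <= k < (d b).+1)
    let E := ((m%:Z - k%:Z) %/ (d b)%:Z)%Z in
    T0 T b (absz (1 + E)) (u + h *~ (2 * k%:Z - 1 - m%:Z + E * (d b)%:Z)).

(* For C tamely laced, C a b < 0 and d a > 1 imply d b %| d a, so that the
   divisions [d a %/ d b] here and in [Nfac] are exact. *)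
Definition Mfac T a m u : R :=
  if (1 < d a)%N then \prod_(b | C a b < 0) T0 T b (d a %/ d b * m)%N u
  else \prod_(b | C a b < 0) Sfac T b m u.

Definition T_system T : Prop :=
  forall a m u, (0 < m)%N ->
    T a m (u - h *+ d a) * T a m (u + h *+ d a) =
    T0 T a m.-1 u * T0 T a m.+1 u + Mfac T a m u.

(* The product over -p+1 <= j <= p-1 is indexed by i = p + j. *)
Definition Zfac Y b p m u : R :=
  \prod_(1 <= i < 2 * p)
    let j : int := i%:Z - p%:Z in
    \prod_(1 <= k < (p - absz j).+1)
      (1 + Y b (absz (p%:Z * m%:Z + j))
               (u + h *~ (p%:Z - `|j| + 1 - 2 * k%:Z))).

Definition Yfrac Y b m u : R :=
  if (d b %| m)%N then Y b (m %/ d b)%N u else 0.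

Definition Nfac Y a m u : R :=
  if (1 < d a)%N then \prod_(b | C a b < 0) Zfac Y b (d a %/ d b)%N m u
  else \prod_(b | C a b < 0) (1 + Yfrac Y b m u).

Definition Y_system Y : Prop :=
  forall a m u, (0 < m)%N ->
    Y a m (u - h *+ d a) * Y a m (u + h *+ d a) =
    Nfac Y a m u / ((1 + Yinv0 Y a m.-1 u) * (1 + Yinv0 Y a m.+1 u)).

Definition Y_of_T T a m u : R :=
  Mfac T a m u / (T0 T a m.-1 u * T0 T a m.+1 u).

Definition T_lift Y T : Prop :=
  [/\ unit_family T, T_system T
    & forall a m u, (0 < m)%N -> Y a m u = Y_of_T T a m u].

End Systems.

(* Main.v *)
Require Import Defs.
From HB Require Import structures.
From mathcomp Require Import all_boot all_order all_algebra.
From mathcomp Require Import complex.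
From mathcomp Require Import boolp reals trigo.
From mathcomp Require Import zify ring.

Set Implicit Arguments.
Unset Strict Implicit.
Unset Printing Implicit Defensive.

Import Order.TTheory GRing.Theory Num.Theory.

Local Open Scope ring_scope.

(** Write h for the element 1/t of U, and call T split by Y when
    (1 + Y_m) T_{m-1} T_{m+1} = T_m(u - d_a h) T_m(u + d_a h), which is the
    first displayed formula for 1 + Y in cross-multiplied form ([splits_Y]).
    Everything rests on one multiplicative identity valid for every split T:

      N_m(u) M_{m-1}(u) M_{m+1}(u) = M_m(u - d_a h) M_m(u + d_a h)

    ([Mfac_shift]).  It is proved factor by factor.  The factors of M and N are
    all made of strings f(u + (s-1)h) f(u + (s-3)h) ... f(u - (s-1)h), which
    obey the rank-one relation [string_shift].  A factor S_m of M is a product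
    of two strings, of T_{q+1} and of T_q, where q is the quotient of m by d_b;
    a factor Z_{p,m} of N is a product of strings of 1 + Y over a rhombus of
    indices, which telescopes to its four corners ([diamond]).

    Next to M consider the other candidate X_m = Y_m T_{m-1} T_{m+1}, with
    X_0 = 1 ([YTT]).  If T is split by Y then
    T_m(u - d_a h) T_m(u + d_a h) = (1 + Y_m^-1) X_m, whence X_m satisfies the
    same three-term identity as M_m with N_m replaced by
    Y_m(u - d_a h) Y_m(u + d_a h) (1 + Y_{m-1}^-1) (1 + Y_{m+1}^-1)
    ([YTT_shift]).

    From T to Y: here X = M by definition of Y, so comparing the two identities
    and cancelling gives the Y-system.

    From Y to T: T_1 determines a unique T split by Y ([T_of_T1]), and the
    T-system for it amounts to X = M.  The Y-system makes the two three-term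
    identities coincide, so X = M follows by induction on m from X_1 = M_1
    ([T_lift_of_splits]).  The equation X_1 = M_1 reads

      T_1(u - d_a h) T_1(u + d_a h) = (1 + Y_1(u)^-1) M_1(u),

    where M_1(u) only involves the values of T_1 at the points u + j h with
    |j| < d_a.  Since h has infinite order in U, a coset of Z h is a copy of Z,
    and this is a recursion that can be run forwards and backwards from
    arbitrary values of T_1 on the window -d_a <= n < d_a ([T_lift_exists]).
    Two different constant values on the window give two different lifts.
    A unit other than 1 is available because Y_1 and 1 + Y_1 are distinct
    units. *)

(** * Telescoping products and strings *)

(** The telescoping of x_j = (f_j / f_{j+1}) (g_{j+1} / g_j), stated without
    divisions because R is only a ring with units. *)
Lemma mulr_telescope (R : comUnitRingType) (n : nat) (x f g : nat -> R) :
  (forall j, (j < n)%N -> f j \is a GRing.unit) ->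
  (forall j, (j < n)%N -> g j \is a GRing.unit) ->
  (forall j, (j < n)%N -> x j * (g j * f j.+1) = f j * g j.+1) ->
  (\prod_(j < n) x j) * (g 0%N * f n) = f 0%N * g n.
Proof.
elim: n => [|n IH] fu gu E; first by rewrite big_ord0 mul1r mulrC.
have {}IH := IH (fun j lj => fu j (leqW lj)) (fun j lj => gu j (leqW lj))
                (fun j lj => E j (leqW lj)).
rewrite big_ord_recr /=; set P := \prod_(j < n) _ in IH *.
apply: (mulIr (fu n (ltnSn n))); apply: (mulIr (gu n (ltnSn n))).
transitivity (P * (g 0%N * f n) * (x n * (g n * f n.+1))); first by ring.
by rewrite IH E //; ring.
Qed.

Section Strings.

Context (U : zmodType) (h : U) (R : comUnitRingType).
Implicit Types (f g : U -> R) (s : nat) (u : U).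

(** The s points of a string are spaced by 2h and centred at u. *)
Definition string f s u : R := \prod_(i < s) f (u + h *~ (s%:Z - 1 - 2 * i%:Z)).

Lemma string0 f u : string f 0 u = 1.
Proof. by rewrite /string big_ord0. Qed.

Lemma string1 f u : string f 1 u = f u.
Proof. by rewrite /string big_ord1 -[in RHS](addr0 u) -(mulr0z h). Qed.

Lemma string_const1 s u : string (fun=> 1) s u = 1.
Proof. exact: big1. Qed.

Lemma string_rev f s u :
  string f s u = \prod_(i < s) f (u + h *~ (2 * i%:Z + 1 - s%:Z)).
Proof.
rewrite /string (reindex_inj rev_ord_inj) /=; apply: eq_bigr => i _.
by congr (f (u + h *~ _)); have := ltn_ord i; lia.
Qed.

Lemma stringM f g s u :
  string (fun v => f v * g v) s u = string f s u * string g s u.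
Proof. exact: big_split. Qed.

Lemma eq_string f g s u : f =1 g -> string f s u = string g s u.
Proof. by move=> fg; apply: eq_bigr. Qed.

Lemma string_unit f s u :
  (forall v, f v \is a GRing.unit) -> string f s u \is a GRing.unit.
Proof. by move=> fu; apply: rpred_prod. Qed.

Lemma addzr u (i j : int) : u + h *~ i + h *~ j = u + h *~ (i + j).
Proof. by rewrite -addrA mulrzDr. Qed.

Lemma string_recr f s u :
  string f s.+1 u = string f s (u + h) * f (u - h *+ s).
Proof.
rewrite /string big_ord_recr /=; congr (_ * _).
  by apply: eq_bigr => i _; rewrite -[in RHS](mulr1z h) addzr;
     congr (f (u + h *~ _)); lia.
by rewrite pmulrn -mulrNz; congr (f (u + h *~ _)); lia.
Qed.

Lemma string_recl f s u :
  string f s.+1 u = f (u + h *+ s) * string f s (u - h).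
Proof.
rewrite /string big_ord_recl /=; congr (_ * _).
  by rewrite pmulrn; congr (f (u + h *~ _)); lia.
apply: eq_bigr => i _; rewrite -(mulrN1z h) addzr.
by congr (f (u + h *~ _)); rewrite /bump /=; lia.
Qed.

Lemma string_ends f s u :
  string f s.+2 u = string f s u * (f (u - h *+ s.+1) * f (u + h *+ s.+1)).
Proof.
by rewrite string_recl string_recr subrK -(addrA u (- h)) -opprD -mulrS; ring.
Qed.

(** The strings of lengths s + 1 at u - h and u + h cover s + 2 points around u,
    the inner s of them twice. *)
Lemma string_shift f s u :
  string f s.+1 (u - h) * string f s.+1 (u + h) =
  string f s.+2 u * string f s u.
Proof.
rewrite [string f s.+1 (u + h)]string_recl addrK -(addrA u) -mulrS.
by rewrite [string f s.+2 u]string_recl; ring.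
Qed.

End Strings.

(** * The factors S and Z in terms of strings *)

Section Sfac.

Context (r : nat) (d : 'I_r -> nat) (U : zmodType) (h : U) (R : comUnitRingType).
Context (T : 'I_r -> nat -> U -> R) (b : 'I_r) (db_gt0 : (0 < d b)%N).

(** For m = q d_b + s the floor of (m - k) / d_b is q for k <= s and q - 1 for
    k > s, so the product over k breaks into two strings.  Both s = 0 and
    s = d_b are allowed: the boundary case has two descriptions, and
    [Sfac_shift] uses whichever fits. *)
Lemma Sfac_string q s u : (s <= d b)%N ->
  Sfac d h T b (q * d b + s) u =
  string h (T0 T b q.+1) s u * string h (T0 T b q) (d b - s) u.
Proof.
move=> sd; rewrite /Sfac (big_cat_nat (n := s.+1)) ?ltnS //=; congr (_ * _).
  rewrite big_add1 big_mkord [s.+1.-1]/= string_rev; apply: eq_bigr => i _.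
  have lt_is := ltn_ord i.
  have -> : ((q * d b + s)%N%:Z - i.+1%:Z = q%:Z * (d b)%:Z + (s - i.+1)%N%:Z)%R.
    by rewrite -subzn //; lia.
  rewrite divzMDl ?divz_nat ?divn_small; try lia.
  by congr (T0 T b _ (u + h *~ _)); lia.
rewrite -[s.+1]add0n big_addn subSS big_mkord string_rev.
apply: eq_bigr => i _; have lt_is := ltn_ord i.
have -> : ((q * d b + s)%N%:Z - (i + s.+1)%N%:Z =
           (q%:Z - 1) * (d b)%:Z + (d b - i.+1)%N%:Z)%R.
  by rewrite -subzn; lia.
rewrite divzMDl ?divz_nat ?divn_small; try lia.
by congr (T0 T b _ (u + h *~ _)); lia.
Qed.

End Sfac.

(** Abstract setting of the rhombus identity: t is a family of rows t_l, and x is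
    the multiplicative discrete wave operator applied to t. *)
Section Diamond.

Context (U : zmodType) (h : U) (R : comUnitRingType) (x t : nat -> U -> R).
Context (t_unit : forall l v, t l v \is a GRing.unit).
Context (xt : forall l v,
  x l.+1 v * (t l v * t l.+2 v) = t l.+1 (v - h) * t l.+1 (v + h)).

Local Notation A l s u := (string h (t l) s u).

Let A_unit l s u : A l s u \is a GRing.unit.
Proof. exact: string_unit. Qed.

(** One row of the rhombus, by [string_shift] in row l + 1. *)
Lemma string_xt l s u :
  string h (x l.+1) s.+1 u * (A l s.+1 u * A l.+2 s.+1 u) =
  A l.+1 s.+2 u * A l.+1 s u.
Proof.
rewrite -string_shift -!stringM (eq_string _ _ _ (xt l)) stringM.
by congr (_ * _); apply: eq_bigr => i _; rewrite addrAC.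
Qed.

(** The rhombus is cut into the rows above its horizontal diagonal, the diagonal
    included, and the rows below it; each part telescopes separately. *)
Lemma diamond_upper c p u :
  (\prod_(j < p) string h (x (c + j).+1) (p - j) u) * (A c p u * t (c + p).+1 u) =
  A c.+1 p.+1 u.
Proof.
have := @mulr_telescope R p (fun j => string h (x (c + j).+1) (p - j) u)
  (fun j => A (c + j).+1 (p - j).+1 u) (fun j => A (c + j) (p - j) u).
rewrite /= !addn0 !subn0 subnn string0 mulr1 string1; apply=> // j lt_jp.
by rewrite -(subnSK lt_jp) addnS string_xt.
Qed.

Lemma diamond_lower c p u : (p <= c)%N ->
  (\prod_(j < p) string h (x (c - j)) (p - j) u) * (A c.+1 p u * t (c - p) u) =
  A c p.+1 u.
Proof.
move=> le_pc.
have := @mulr_telescope R p (fun j => string h (x (c - j)) (p - j) u)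
  (fun j => A (c - j) (p - j).+1 u) (fun j => A (c - j).+1 (p - j) u).
rewrite /= !subn0 subnn string0 mulr1 string1; apply=> // j lt_jp.
rewrite -(subnSK lt_jp) -(subnSK (leq_trans lt_jp le_pc)).
by rewrite [A _.+2 _ _ * _]mulrC string_xt.
Qed.

(** After both halves are telescoped, what is left of the horizontal diagonal is
    a quotient of strings of lengths p + 1 and p - 1, that is, its two end
    points ([string_ends]). *)
Lemma diamond q p u : (0 < p)%N -> (p <= q)%N ->
  (\prod_(1 <= i < 2 * p)
     string h (x (absz (q%:Z + (i%:Z - p%:Z)))) (p - absz (i%:Z - p%:Z)) u)
    * (t (q - p) u * t (q + p) u) =
  t q (u - h *+ p) * t q (u + h *+ p).
Proof.
case: p => // p _; case: q => // c le_pc.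
rewrite (big_cat_nat (n := p.+1)) /=; [|lia|lia].
set Q1 := \prod_(1 <= i < p.+1) _; set Q2 := \prod_(p.+1 <= i < _) _.
have low : Q1 * (A c.+1 p u * t (c - p) u) = A c p.+1 u.
  rewrite -diamond_lower //; congr (_ * _).
  rewrite /Q1 big_nat_rev big_add1 big_mkord [_.+1.-1]/=.
  apply: eq_bigr => j _; have lt_jp := ltn_ord j.
  by congr (string h (x _) _ u); lia.
have up : Q2 * (A c p.+1 u * t (c + p.+1).+1 u) = A c.+1 p.+2 u.
  rewrite -diamond_upper; congr (_ * _).
  rewrite /Q2 -[p.+1 in X in \prod_(X <= _ < _) _]add0n big_addn.
  rewrite (_ : 2 * p.+1 - p.+1 = p.+1)%N ?big_mkord; last by lia.
  apply: eq_bigr => j _; have lt_jp := ltn_ord j.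
  by congr (string h (x _) _ u); lia.
apply: (mulIr (A_unit c.+1 p u)); apply: (mulIr (A_unit c p.+1 u)).
rewrite subSS addSn.
transitivity (Q1 * (A c.+1 p u * t (c - p) u) *
              (Q2 * (A c p.+1 u * t (c + p.+1).+1 u))); first by ring.
by rewrite low up string_ends; ring.
Qed.

End Diamond.

Section Couplings.

Context (r : nat) (C : 'M[int]_r) (d : 'I_r -> nat).
Context (U : zmodType) (h : U) (R : comUnitRingType).
Implicit Types (T Y : 'I_r -> nat -> U -> R) (a b : 'I_r) (m p : nat) (u : U).

(** The formula for 1 + Y in terms of T, with denominators cleared so that it
    makes sense before T is known to be a family of units. *)
Definition splits_Y Y T : Prop := forall a m u, (0 < m)%N ->
  (1 + Y a m u) * (T0 T a m.-1 u * T0 T a m.+1 u) =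
  T a m (u - h *+ d a) * T a m (u + h *+ d a).

Lemma T0_unit T : unit_family T -> forall a m u, T0 T a m u \is a GRing.unit.
Proof. by move=> Tu a [|m] u /=; [apply: unitr1 | apply: Tu]. Qed.

Context (d_gt0 : forall a, (0 < d a)%N).

Lemma Sfac_unit T : unit_family T ->
  forall b m u, Sfac d h T b m u \is a GRing.unit.
Proof. by move=> Tu b m u; apply: rpred_prod => k _; apply: T0_unit. Qed.

(** Put m = q d_b + s with 1 <= s <= d_b.  For s < d_b both strings of S_m are
    subject to [string_shift] and nothing is left over.  For s = d_b the second
    string is empty, and the end points of the first one produce the factor
    1 + Y_{q+1}. *)
Lemma Sfac_shift T Y b m u : splits_Y Y T -> (0 < m)%N ->
  (1 + Yfrac d Y b m u) * (Sfac d h T b m.-1 u * Sfac d h T b m.+1 u) =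
  Sfac d h T b m (u - h) * Sfac d h T b m (u + h).
Proof.
move=> YT; case: m => // m _ /=; have db := d_gt0 b.
have S v q s := @Sfac_string _ d _ h _ T b db q s v.
rewrite (divn_eq m (d b)); move: (m %/ d b)%N (ltn_pmod m db) => q.
move: (m %% d b)%N => {m} s lt_sd; rewrite -!addnS.
(* Here the index m of the statement is q d_b + s + 1. *)
have [lt_s1d | le_ds1] := ltnP s.+1 (d b).
  have -> : Yfrac d Y b (q * d b + s.+1) u = 0.
    by rewrite /Yfrac dvdn_addr ?dvdn_mull // gtnNdvd.
  rewrite addr0 mul1r !S; try lia.
  rewrite -(subnSK lt_sd) -(subnSK lt_s1d) mulrACA [RHS]mulrACA !string_shift.
  by ring.
have Es : d b = s.+1 by lia.
have -> : Yfrac d Y b (q * d b + s.+1) u = Y b q.+1 u.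
  by rewrite /Yfrac -Es -mulSnr dvdn_mull ?dvdnn // mulnK.
have -> : (q * d b + s.+2 = q.+1 * d b + 1)%N by rewrite mulSnr Es; lia.
rewrite !S; try lia.
rewrite Es subSn // !subnn subn1 /= !string0 !string1 !mulr1.
rewrite string_shift string_ends /= -Es.
rewrite -[T b q.+1 _ * _](YT b q.+1) //=.
by ring.
Qed.

Lemma Zfac_string Y b p m u :
  Zfac h Y b p m u =
  \prod_(1 <= i < 2 * p) string h
    (fun v => 1 + Y b (absz ((p * m)%N%:Z + (i%:Z - p%:Z))) v)
    (p - absz (i%:Z - p%:Z)) u.
Proof.
rewrite /Zfac /string !big_nat; apply: eq_bigr => i lt_i.
rewrite big_add1 big_mkord [_.+1.-1]/=; apply: eq_bigr => k _.
rewrite PoszM; congr (1 + Y b _ (u + h *~ _)).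
have le_jp : (absz (i%:Z - p%:Z) <= p)%N by lia.
move: (nat_of_ord k) => {k} k; rewrite -abszE; move: (absz _) le_jp => n le_np.
by lia.
Qed.

Lemma Zfac1 Y b m u : Zfac h Y b 1 m u = 1 + Y b m u.
Proof.
by rewrite Zfac_string big_nat1 string1 subrr addr0 mul1n.
Qed.

Lemma Zfac_shift T Y b p m u : unit_family T -> splits_Y Y T ->
  d b = 1%N -> (0 < p)%N -> (0 < m)%N ->
  Zfac h Y b p m u * (T0 T b (p * m.-1) u * T0 T b (p * m.+1) u) =
  T0 T b (p * m) (u - h *+ p) * T0 T b (p * m) (u + h *+ p).
Proof.
move=> Tu YT db1 p0 m0; rewrite -(@diamond _ _ _ (fun l v => 1 + Y b l v)) //.
- by rewrite Zfac_string -subn1 mulnBr muln1 mulnS [(p + _)%N]addnC.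
- by move=> l v; apply: T0_unit.
- by move=> l v; have := YT b l.+1 v isT; rewrite db1.
- by rewrite leq_pmulr.
Qed.

Lemma Mfac0 T a u : Mfac C d h T a 0 u = 1.
Proof.
rewrite /Mfac; case: ifP => _; apply: big1 => b _; first by rewrite muln0.
rewrite -[0%N](addn0 (0 * d b)%N) Sfac_string // string0 mul1r.
exact: string_const1.
Qed.

Lemma Mfac_unit T : unit_family T ->
  forall a m u, Mfac C d h T a m u \is a GRing.unit.
Proof.
move=> Tu a m u; rewrite /Mfac; case: ifP => _; apply: rpred_prod => b _.
  exact: T0_unit.
exact: Sfac_unit.
Qed.

(** The consequence of tameness that matters: when d_a > 1, a neighbour b has
    either d_b = 1, where the full rhombus of size d_a occurs, or d_b = d_a,
    where Z is a single factor. *)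
Context (d_dichotomy :
  forall a b, (1 < d a)%N -> C a b < 0 -> d b = 1%N \/ d b = d a).

Lemma Mfac_shift T Y a m u : unit_family T -> splits_Y Y T -> (0 < m)%N ->
  Nfac C d h Y a m u * (Mfac C d h T a m.-1 u * Mfac C d h T a m.+1 u) =
  Mfac C d h T a m (u - h *+ d a) * Mfac C d h T a m (u + h *+ d a).
Proof.
move=> Tu YT m0; rewrite /Nfac /Mfac; case: ifP => [da_gt1 | /negbT da_le1].
  rewrite -!big_split; apply: eq_bigr => b Cab /=.
  case: (d_dichotomy da_gt1 Cab) => db.
    by rewrite db divn1 Zfac_shift.
  rewrite db divnn d_gt0 !mul1n Zfac1 YT // db.
  by case: (m) m0.
have da : d a = 1%N by have := d_gt0 a; lia.
rewrite da mulr1n -!big_split; apply: eq_bigr => b _ /=.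
exact: Sfac_shift.
Qed.

End Couplings.

(** * Comparing M with Y_m T_{m-1} T_{m+1} *)

Section Correspondence.

Context (r : nat) (C : 'M[int]_r) (d : 'I_r -> nat).
Context (U : zmodType) (h : U) (R : comUnitRingType).
Implicit Types (T Y : 'I_r -> nat -> U -> R) (a b : 'I_r) (m : nat) (u : U).

Context (d_gt0 : forall a, (0 < d a)%N).
Context (d_dichotomy :
  forall a b, (1 < d a)%N -> C a b < 0 -> d b = 1%N \/ d b = d a).

(** The value at 0 matches M_0 = 1, and makes [splits_Yinv] hold at m = 0 with
    the conventions T_0 = 1 and Y_0^-1 = 0. *)
Definition YTT Y T a m u : R :=
  if m is 0 then 1 else Y a m u * (T0 T a m.-1 u * T0 T a m.+1 u).

Lemma splits_Yinv Y T a m u : unit_family Y -> splits_Y d h Y T ->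
  T0 T a m (u - h *+ d a) * T0 T a m (u + h *+ d a) =
  (1 + Yinv0 Y a m u) * YTT Y T a m u.
Proof.
move=> Yu YT; case: m => [|m]; first by rewrite /= addr0.
rewrite -[LHS](YT a m.+1) //= [RHS]mulrA; congr (_ * _).
by rewrite mulrDl mul1r mulVr ?Yu // addrC.
Qed.

(** Group the shifted factors T_{m-1} and T_{m+1} and apply [splits_Yinv] to
    each pair. *)
Lemma YTT_shift Y T a m u : unit_family Y -> splits_Y d h Y T -> (0 < m)%N ->
  YTT Y T a m (u - h *+ d a) * YTT Y T a m (u + h *+ d a) =
  Y a m (u - h *+ d a) * Y a m (u + h *+ d a)
    * ((1 + Yinv0 Y a m.-1 u) * (1 + Yinv0 Y a m.+1 u))
    * (YTT Y T a m.-1 u * YTT Y T a m.+1 u).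
Proof.
move=> Yu YT; case: m => // m _; rewrite [m.+1.-1]/=.
have Em := splits_Yinv a m u Yu YT; have Em2 := splits_Yinv a m.+2 u Yu YT.
transitivity (Y a m.+1 (u - h *+ d a) * Y a m.+1 (u + h *+ d a)
  * ((T0 T a m (u - h *+ d a) * T0 T a m (u + h *+ d a))
     * (T0 T a m.+2 (u - h *+ d a) * T0 T a m.+2 (u + h *+ d a)))).
  by rewrite /YTT /=; ring.
by rewrite Em Em2; ring.
Qed.

Section FromT.

Context (T : 'I_r -> nat -> U -> R) (Tu : unit_family T).
Context (TT : T_system C d h T).
Local Notation Y := (Y_of_T C d h T).

Let TT_unit a m u : T0 T a m.-1 u * T0 T a m.+1 u \is a GRing.unit.
Proof. by rewrite unitrM !T0_unit. Qed.

Lemma Y_of_T_unit : unit_family Y.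
Proof. by move=> a m u _; rewrite unitrM unitrV TT_unit Mfac_unit. Qed.

Lemma Y_of_T_YTT a m u : YTT Y T a m u = Mfac C d h T a m u.
Proof. by case: m => [|m]; rewrite /= ?Mfac0 // /Y_of_T divrK. Qed.

Lemma Y_of_T_splits : splits_Y d h Y T.
Proof. by move=> a m u m0; rewrite mulrDl mul1r divrK // -TT. Qed.

Lemma Y_of_T_add1 a m u : (0 < m)%N ->
  1 + Y a m u = T a m (u - h *+ d a) * T a m (u + h *+ d a)
                  / (T0 T a m.-1 u * T0 T a m.+1 u).
Proof. by move=> m0; rewrite -Y_of_T_splits // mulrK. Qed.

Lemma Y_of_T_addV1 a m u : (0 < m)%N ->
  1 + (Y a m u)^-1 = T a m (u - h *+ d a) * T a m (u + h *+ d a)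
                       / Mfac C d h T a m u.
Proof.
move=> m0; have := splits_Yinv a m u Y_of_T_unit Y_of_T_splits.
by rewrite Y_of_T_YTT; case: m m0 => // m _ /= ->; rewrite mulrK ?Mfac_unit.
Qed.

(** By [splits_Yinv], this element divides a product of two units. *)
Lemma Y_of_T_Yinv0_unit a m u : 1 + Yinv0 Y a m u \is a GRing.unit.
Proof.
have := splits_Yinv a m u Y_of_T_unit Y_of_T_splits.
move/(congr1 (fun z => z \is a GRing.unit)); rewrite Y_of_T_YTT !unitrM.
by rewrite !T0_unit // => /esym/andP[].
Qed.

(** Both three-term identities now hold for M; cancel M_{m-1} M_{m+1}. *)
Lemma Y_of_T_Y_system : Y_system C d h Y.
Proof.
move=> a m u m0.
have := YTT_shift a u Y_of_T_unit Y_of_T_splits m0.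
rewrite !Y_of_T_YTT -(Mfac_shift d_gt0 d_dichotomy a u Tu Y_of_T_splits m0).
move/(mulIr _) => -> ; last by rewrite unitrM !Mfac_unit.
by rewrite mulrK // unitrM !Y_of_T_Yinv0_unit.
Qed.

End FromT.

(** The last hypothesis is the case m = 1 of the second displayed formula, for
    1 + Y^-1; the Y-system propagates it to all m. *)
Lemma T_lift_of_splits Y T :
  unit_family Y -> (forall a m u, (0 < m)%N -> 1 + (Y a m u)^-1 \is a GRing.unit) ->
  Y_system C d h Y -> unit_family T -> splits_Y d h Y T ->
  (forall a u, T a 1%N (u - h *+ d a) * T a 1%N (u + h *+ d a) =
               (1 + (Y a 1%N u)^-1) * Mfac C d h T a 1 u) ->
  T_lift C d h Y T.
Proof.
move=> Yu Yiu YY Tu YT base.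
have TTu a m u : T0 T a m.-1 u * T0 T a m.+1 u \is a GRing.unit.
  by rewrite unitrM !T0_unit.
have Yi0u a m u : 1 + Yinv0 Y a m u \is a GRing.unit.
  by case: m => [|m] /=; rewrite ?addr0 ?unitr1 ?Yiu.
have N_unit a m u : (0 < m)%N -> Nfac C d h Y a m u \is a GRing.unit.
  move=> m0; have := Mfac_shift d_gt0 d_dichotomy a u Tu YT m0.
  move/(congr1 (fun z => z \is a GRing.unit)).
  by rewrite !unitrM !Mfac_unit //= andbT.
have YTT_M a m u : YTT Y T a m u = Mfac C d h T a m u.
  suff: (forall u, YTT Y T a m u = Mfac C d h T a m u) /\
        (forall u, YTT Y T a m.+1 u = Mfac C d h T a m.+1 u) by case.
  elim: m {u} => [|m [IHm IHm1]]; split=> // u; first by rewrite Mfac0.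
    have := splits_Yinv a 1 u Yu YT; rewrite base /= => /(mulrI _) <- //.
    exact: Yiu.
  have := YTT_shift a u Yu YT (ltn0Sn m); rewrite YY // divrK; last first.
    by rewrite unitrM !Yi0u.
  rewrite !IHm1 -(Mfac_shift d_gt0 d_dichotomy a u Tu YT) //= IHm.
  move/(mulrI (N_unit a m.+1 u isT)) => /(mulrI _) <- //.
  exact: Mfac_unit.
split=> // a m u m0.
  by rewrite -YT // mulrDl mul1r -YTT_M /YTT; case: (m) m0.
by rewrite /Y_of_T -YTT_M /YTT; case: (m) m0 => // n _; rewrite mulrK.
Qed.

End Correspondence.

(** * A coordinate along the orbits of the step, and recursion on it *)

(** Choose a base point in every coset of Z h and count steps from it. *)
Lemma coset_coordinate (U : zmodType) (h : U) :
  (forall n : int, h *~ n = 0 -> n = 0) ->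
  exists c : U -> int, forall u n, c (u + h *~ n) = c u + n.
Proof.
move=> h_free.
pose P (u v : U) := `[< exists n : int, u = v + h *~ n >].
(* The function u |-> choose (P u) u picks the base point: [choose] depends
   only on the extension of P u, hence only on the coset of u. *)
have rep_ex u : exists n : int, u = choose (P u) u + h *~ n.
  apply/asboolP; apply: (@chooseP _ (P u)); apply/asboolP; exists 0.
  by rewrite mulr0z addr0.
have rep_shift u n : choose (P (u + h *~ n)) (u + h *~ n) = choose (P u) u.
  have PP : P (u + h *~ n) =1 P u.
    move=> v; apply/asboolP/asboolP => -[k E].
      by exists (k - n); rewrite mulrzBr addrA -E addrK.
    by exists (k + n); rewrite mulrzDr addrA -E.
  rewrite (eq_choose PP); apply: choose_id; apply/asboolP.
    by exists (- n); rewrite mulrNz addrK.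
  by exists 0; rewrite mulr0z addr0.
exists (fun u => projT1 (cid (rep_ex u))) => u n.
case: (cid (rep_ex u)) => i /= Ei; case: (cid (rep_ex _)) => j /=.
rewrite rep_shift {1}Ei -addrA => /addrI; rewrite -mulrzDr => /eqP.
by rewrite -subr_eq0 -mulrzBr => /eqP/h_free/eqP; rewrite subr_eq0 => /eqP.
Qed.

(** Recursion on a measure, for a functional Phi given as a whole rather than by
    its recursive calls; P is an invariant of the values.  The solution at x is
    read off from the iterates of Phi, which are stationary at x after mu x + 1
    steps. *)
Lemma measure_fixpoint (X A : Type) (mu : X -> nat) (P : A -> Prop)
    (Phi : (X -> A) -> X -> A) (a0 : A) :
  P a0 ->
  (forall f, (forall x, P (f x)) -> forall x, P (Phi f x)) ->
  (forall f g x, (forall y, (mu y < mu x)%N -> f y = g y) -> Phi f x = Phi g x) ->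
  exists f, (forall x, P (f x)) /\ (forall x, f x = Phi f x).
Proof.
move=> Pa0 PPhi local; pose F k := iter k Phi (fun=> a0).
have stable n x k l : (mu x < n)%N -> (mu x < k)%N -> (mu x < l)%N -> F k x = F l x.
  elim: n x k l => // n IH x [|k] [|l] //= xn xk xl; apply: local => y yx.
  by apply: IH; lia.
exists (fun x => F (mu x).+1 x); split=> x.
  by move: (mu x).+1 => k; elim: k x => //= k IH x; apply: PPhi.
by apply: local => y yx; apply: (stable (mu x)); lia.
Qed.

(** * Construction of the lifts *)

Section Construction.

Context (r : nat) (C : 'M[int]_r) (d : 'I_r -> nat).
Context (U : zmodType) (h : U) (R : comUnitRingType).
Context (Y : 'I_r -> nat -> U -> R).
Implicit Types (tau : 'I_r -> U -> R) (a b : 'I_r) (m : nat) (u : U).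

Context (d_gt0 : forall a, (0 < d a)%N).

(** Solving [splits_Y] for T_{m+1} recovers T from its first row tau. *)
Fixpoint T_of_T1 tau a m u : R :=
  match m with
  | 0 => 1
  | 1 => tau a u
  | (m1.+1 as m2).+1 =>
      T_of_T1 tau a m2 (u - h *+ d a) * T_of_T1 tau a m2 (u + h *+ d a)
        / (T_of_T1 tau a m1 u * (1 + Y a m2 u))
  end.

Lemma T0_T_of_T1 tau a m u : T0 (T_of_T1 tau) a m u = T_of_T1 tau a m u.
Proof. by case: m. Qed.

(** T_m(u) is built from T_{m-1}(u - d_b h), T_{m-1}(u + d_b h) and T_{m-2}(u),
    so the dependence on the first row spreads by d_b at each level. *)
Lemma T_of_T1_local tau tau' b m u :
  (forall j : int, (absz j + d b <= m * d b)%N ->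
     tau b (u + h *~ j) = tau' b (u + h *~ j)) ->
  T_of_T1 tau b m u = T_of_T1 tau' b m u.
Proof.
suff: (forall u, (forall j : int, (absz j + d b <= m * d b)%N ->
        tau b (u + h *~ j) = tau' b (u + h *~ j)) ->
         T_of_T1 tau b m u = T_of_T1 tau' b m u) /\
      (forall u, (forall j : int, (absz j + d b <= m.+1 * d b)%N ->
        tau b (u + h *~ j) = tau' b (u + h *~ j)) ->
         T_of_T1 tau b m.+1 u = T_of_T1 tau' b m.+1 u) by case=> + _; apply.
elim: m {u} => [|m [IHm IHm1]].
  by split=> // u E /=; rewrite -(addr0 u) -(mulr0z h); apply: E; lia.
split=> // u E.
transitivity (T_of_T1 tau b m.+1 (u - h *+ d b) * T_of_T1 tau b m.+1 (u + h *+ d b)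
        / (T_of_T1 tau b m u * (1 + Y b m.+1 u))) => //.
rewrite (IHm1 (u - _)); last first.
  by move=> j lej; rewrite pmulrn -mulrNz addzr; apply: E; lia.
rewrite (IHm1 (u + _)); last first.
  by move=> j lej; rewrite pmulrn addzr; apply: E; lia.
by rewrite (IHm u) // => j lej; apply: E; lia.
Qed.

Lemma Sfac1 (T : 'I_r -> nat -> U -> R) b u : Sfac d h T b 1 u = T b 1%N u.
Proof.
rewrite -[1%N]/(0 * d b + 1)%N Sfac_string // string1 -[RHS]mulr1; congr (_ * _).
exact: string_const1.
Qed.

(** The equation for the first row is centred at u and involves the points
    u - d_a h and u + d_a h of row a.  Strict inequality in this lemma is what
    allows either of them to be solved for. *)
Lemma Mfac1_local tau tau' a u :
  (forall b (j : int), (absz j < d a)%N ->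
     tau b (u + h *~ j) = tau' b (u + h *~ j)) ->
  Mfac C d h (T_of_T1 tau) a 1 u = Mfac C d h (T_of_T1 tau') a 1 u.
Proof.
move=> E; rewrite /Mfac; case: ifP => _; apply: eq_bigr => b _.
  rewrite !T0_T_of_T1 muln1; apply: T_of_T1_local => j le_j; apply: E.
  by have := leq_divM (d a) (d b); have := d_gt0 b; lia.
rewrite !Sfac1; apply: T_of_T1_local => j le_j; apply: E.
by have := d_gt0 a; lia.
Qed.

Context (Y_unit : unit_family Y).
Context (add1Y_unit : forall a m u, (0 < m)%N -> 1 + Y a m u \is a GRing.unit).
Context (add1YV_unit :
  forall a m u, (0 < m)%N -> 1 + (Y a m u)^-1 \is a GRing.unit).

Lemma T_of_T1_unit tau :
  (forall a u, tau a u \is a GRing.unit) ->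
  forall a m u, T_of_T1 tau a m u \is a GRing.unit.
Proof.
move=> tauu a m.
suff: (forall u, T_of_T1 tau a m u \is a GRing.unit) /\
      (forall u, T_of_T1 tau a m.+1 u \is a GRing.unit) by case.
elim: m => [|m [IHm IHm1]]; first by split=> u //=; apply: unitr1.
split=> // u.
change (T_of_T1 tau a m.+1 (u - h *+ d a) * T_of_T1 tau a m.+1 (u + h *+ d a)
        / (T_of_T1 tau a m u * (1 + Y a m.+1 u)) \is a GRing.unit).
by rewrite !(unitrM, unitrV) !IHm1 IHm add1Y_unit.
Qed.

Lemma T_of_T1_splits tau :
  (forall a u, tau a u \is a GRing.unit) -> splits_Y d h Y (T_of_T1 tau).
Proof.
move=> tauu a [|m] u // _; rewrite !T0_T_of_T1 [m.+1.-1]/=.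
have -> : T_of_T1 tau a m.+2 u =
    T_of_T1 tau a m.+1 (u - h *+ d a) * T_of_T1 tau a m.+1 (u + h *+ d a)
      / (T_of_T1 tau a m u * (1 + Y a m.+1 u)) by [].
rewrite mulrA [(1 + _) * _]mulrC [LHS]mulrC divrK //.
by rewrite unitrM T_of_T1_unit ?add1Y_unit.
Qed.

Context (h_free : forall n : int, h *~ n = 0 -> n = 0).
Context (d_dichotomy :
  forall a b, (1 < d a)%N -> C a b < 0 -> d b = 1%N \/ d b = d a).
Context (Y_sys : Y_system C d h Y).

(** Let c be a coordinate with c u0 = 0 and solve for the first row tau.  At a
    point (a, u) with -d_a <= c u < d_a the value w is prescribed.  Further to
    the right the value comes from the equation centred at u - d_a h, further
    to the left from the one centred at u + d_a h.  An equation centred at a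
    point of coordinate >= 0 is used exactly once, to the right, and one centred
    at a point of negative coordinate exactly once, to the left. *)
Lemma T_lift_exists (w : R) (u0 : U) : w \is a GRing.unit ->
  exists T, T_lift C d h Y T /\ forall a, T a 1%N u0 = w.
Proof.
move=> wu; have [c c_shift c_u0] : exists2 c : U -> int,
    forall u n, c (u + h *~ n) = c u + n & c u0 = 0.
  have [c c_shift] := coset_coordinate h_free.
  by exists (fun u => c u - c u0) => [u n|]; rewrite ?subrr // c_shift addrAC.
have c_shiftD u n : c (u + h *+ n) = c u + n%:Z by rewrite pmulrn c_shift.
have c_shiftB u n : c (u - h *+ n) = c u - n%:Z by rewrite pmulrn -mulrNz c_shift.
pose rhs (tau : 'I_r * U -> R) a u :=
  (1 + (Y a 1%N u)^-1) * Mfac C d h (T_of_T1 (fun b v => tau (b, v))) a 1 u.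
pose Phi (tau : 'I_r * U -> R) x := let: (a, u) := x in
  if (- (d a)%:Z <= c u) && (c u < (d a)%:Z) then w else
  if (d a)%:Z <= c u then
    rhs tau a (u - h *+ d a) / tau (a, u - h *+ d a - h *+ d a)
  else rhs tau a (u + h *+ d a) / tau (a, u + h *+ d a + h *+ d a).
(* All recursive calls decrease |c u|, except that the point of coordinate d_a
   calls the one of coordinate -d_a; the last bit decides this tie. *)
pose mu (x : 'I_r * U) := (2 * absz (c x.2) + (0 < c x.2)%R)%N.
have rhs_unit (tau : _ -> R) a u :
    (forall x, tau x \is a GRing.unit) -> rhs tau a u \is a GRing.unit.
  move=> tauu; rewrite unitrM add1YV_unit //; apply: Mfac_unit => // b [] // m v _.
  exact: T_of_T1_unit.
have rhs_local f g a u :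
    (forall b (j : int), (absz j < d a)%N ->
       f (b, u + h *~ j) = g (b, u + h *~ j)) ->
    rhs f a u = rhs g a u.
  by move=> E; congr (_ * _); apply: Mfac1_local.
have [||tau [tauu tauE]] :=
  @measure_fixpoint _ _ mu (fun x => x \is a GRing.unit) Phi w wu.
- move=> f fu [a u] /=; case: ifP => // _.
  by case: ifP => _; rewrite unitrM unitrV fu rhs_unit.
- move=> f g [a u] E /=; have da := d_gt0 a.
  case: ifP => // /negbT out; case: ifP => [fwd | /negbT bwd].
    congr (_ / _); last by apply: E; rewrite /mu /= !c_shiftB; lia.
    by apply: rhs_local => b j lt_j; apply: E; rewrite /mu /= c_shift c_shiftB; lia.
  congr (_ / _); last by apply: E; rewrite /mu /= !c_shiftD; lia.
  by apply: rhs_local => b j lt_j; apply: E; rewrite /mu /= c_shift c_shiftD; lia.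
exists (T_of_T1 (fun b v => tau (b, v))); split; last first.
  move=> a /=; rewrite tauE /= c_u0; have da := d_gt0 a.
  by rewrite (_ : (- (d a)%:Z <= 0) && (0 < (d a)%:Z)) //; lia.
apply: T_lift_of_splits => //.
- by move=> a m u _; apply: T_of_T1_unit.
- exact: T_of_T1_splits.
move=> a u; rewrite [LHS]/= -/(rhs tau a u); have da := d_gt0 a.
have [c_ge0 | c_lt0] := leP 0 (c u).
  rewrite [tau (a, u + h *+ d a)]tauE /= c_shiftD ifF; last lia.
  by rewrite ifT ?addrK; [rewrite mulrC divrK | lia].
rewrite [tau (a, u - h *+ d a)]tauE /= c_shiftB ifF; last lia.
by rewrite ifF ?subrK; [rewrite divrK | lia].
Qed.

End Construction.

(** * The three domains and the theorem *)

(** If d_a > 1 then C_ab = -1, and d_a C_ab = d_b C_ba.  Either C_ba = -1 too and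
    d_a = d_b, or C_ba < -1 and tameness applied to (b, a) gives d_b = 1. *)
Lemma tamely_laced_dichotomy (r : nat) (C : 'M[int]_r) (d : 'I_r -> nat) :
  gen_cartan_matrix C -> tamely_laced C d ->
  forall a b, (1 < d a)%N -> C a b < 0 -> d b = 1%N \/ d b = d a.
Proof.
move=> [_ _ C0] [[d_gt0 DC_sym _] tame] a b da Cab.
have Cba : C b a != 0 by apply/eqP => /C0 Cab0; rewrite Cab0 in Cab.
have sym : (d a)%:Z * C a b = (d b)%:Z * C b a.
  by have /matrixP/(_ b a) := DC_sym; rewrite mxE !mul_diag_mx !mxE.
have Cab1 : C a b = -1.
  suff : ~~ (C a b < -1) by lia.
  by apply/negP => /tame [da1 _]; rewrite da1 in da.
have [/tame [db1 _] | ] := boolP (C b a < -1); first by left.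
by right; rewrite Cab1 in sym; have := d_gt0 b; nia.
Qed.

Lemma lcm_sym_gt0 (r : nat) (d : 'I_r -> nat) :
  (forall a, (0 < d a)%N) -> (0 < lcm_sym d)%N.
Proof.
move=> d_gt0; apply: (big_ind (fun n => 0 < n)%N) => // m n m0 n0.
by rewrite lcmn_gt0 m0.
Qed.

(** For the cylinder, n/t = 2 pi i j / xi with n <> 0 would make xi a rational
    multiple of 2 pi i.  This also covers xi = 0, where the division by xi
    yields 0. *)
Lemma step_free (K : realType) (t : nat) (k : domain_kind K) :
  (0 < t)%N -> forall n : int, step t k *~ n = 0 -> n = 0.
Proof.
move=> t0; have tK (F : numFieldType) (n : int) : t%:R^-1 *~ n = 0 :> F -> n = 0.
  move/eqP; rewrite mulrz_eq0 => /orP[/eqP //|].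
  by rewrite invr_eq0 pnatr_eq0 -leqn0 leqNgt t0.
case: k => [||xi xiP] n /=.
- by move/(congr1 val); rewrite raddfMz raddf0; apply: tK.
- exact: tK.
move=> En; apply/eqP; apply: contraT => n0.
have /asboolP [j Ej] : period_pred xi (t%:R^-1 *~ n).
  have : (\pi_(cylinder xi) (t%:R^-1 *~ n) = \pi_(cylinder xi) 0)%qT.
    by rewrite raddfMz raddf0.
  by move/eqP; rewrite -Quotient.idealrBE subr0.
have xi0 : xi != 0.
  apply: contra n0 => /eqP xi0; apply/eqP/(tK K[i]).
  by rewrite Ej xi0 invr0 mulr0 mul0rz.
case: xiP; exists (t%:R * j%:~R / n%:~R).
rewrite fmorph_div rmorphM /= ratr_nat !ratr_int.
have nz : (n%:~R : K[i]) != 0 by rewrite intr_eq0.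
have tz : (t%:R : K[i]) != 0 by rewrite pnatr_eq0 -lt0n.
move: Ej; rewrite -[LHS]mulrzr -[RHS]mulrzr => Ej.
apply: (mulIf (invr_neq0 xi0)); apply: (mulIf nz); apply: (mulIf (invr_neq0 tz)).
transitivity (t%:R^-1 * n%:~R : K[i]); first by field; rewrite xi0 tz.
by rewrite Ej; field; rewrite nz xi0 tz.
Qed.

Lemma unit_neq1 (R : comUnitRingType) (y : R) :
  y \is a GRing.unit -> 1 + y \is a GRing.unit ->
  exists2 w : R, w \is a GRing.unit & w != 1.
Proof.
move=> yu y1u; have [y1 | ] := eqVneq y 1; last by exists y.
exists (1 + y) => //; rewrite y1 -subr_eq0 addrK; exact: oner_neq0.
Qed.

Theorem theorem4p4 (r : nat) (C : 'M[int]_r) (d : 'I_r -> nat)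
    (K : realType) (k : domain_kind K) (R : comUnitRingType) :
  gen_cartan_matrix C -> tamely_laced C d ->
  let t := lcm_sym d in
  let U : zmodType := domain t k in
  let h : U := step t k in
  (forall T : 'I_r -> nat -> U -> R,
    unit_family T -> T_system C d h T ->
    let Y := Y_of_T C d h T in
    [/\ unit_family Y,
        forall a m u, (0 < m)%N ->
          1 + Y a m u =
          T a m (u - h *+ d a) * T a m (u + h *+ d a)
            / (T0 T a m.-1 u * T0 T a m.+1 u),
        forall a m u, (0 < m)%N ->
          1 + (Y a m u)^-1 =
          T a m (u - h *+ d a) * T a m (u + h *+ d a) / Mfac C d h T a m u
      & Y_system C d h Y]) /\
  (forall Y : 'I_r -> nat -> U -> R,
    unit_family Y ->
    (forall a m u, (0 < m)%N ->
      1 + Y a m u \is a GRing.unit /\ 1 + (Y a m u)^-1 \is a GRing.unit) ->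
    Y_system C d h Y ->
    (exists T : 'I_r -> nat -> U -> R, T_lift C d h Y T) /\
    ~ (forall T T' : 'I_r -> nat -> U -> R,
        T_lift C d h Y T -> T_lift C d h Y T' ->
        forall a m u, (0 < m)%N -> T a m u = T' a m u)).

Proof.
move=> CC tame t U h.
have [[d_gt0 _ d_coprime] _] := tame.
have dich := tamely_laced_dichotomy CC tame.
split=> [T Tu TT Y | Y Yu Y1u YY].
  split.
  - exact: Y_of_T_unit.
  - by move=> a m u; apply: Y_of_T_add1.
  - by move=> a m u; apply: Y_of_T_addV1.
  - exact: Y_of_T_Y_system.
have h_free : forall n : int, h *~ n = 0 -> n = 0.
  by apply: step_free; apply: lcm_sym_gt0.
have lift w : w \is a GRing.unit ->
    exists T, T_lift C d h Y T /\ forall a, T a 1%N 0 = w.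
  apply: T_lift_exists => // a m u m0; by case: (Y1u a m u m0).
split; first by have [T [TL _]] := lift 1 (unitr1 R); exists T.
(* If r = 0 then every integer is a common divisor of the empty family d. *)
have [a0 _] : exists a : 'I_r, true.
  have [r0 | r_gt0] := posnP r; last by exists (Ordinal r_gt0).
  suff : 2%N = 1%N by [].
  by apply: d_coprime => a; have := leq_trans (ltn_ord a) (eq_leq r0).
have [w wu w1] : exists2 w : R, w \is a GRing.unit & w != 1.
  by apply: (@unit_neq1 _ (Y a0 1%N 0)); [apply: Yu | case: (Y1u a0 1%N 0 isT)].
have [T [TL Tw]] := lift w wu; have [T' [TL' Tw']] := lift 1 (unitr1 R).
move=> /(_ T T' TL TL' a0 1%N 0 isT); rewrite Tw Tw' => w_eq1.
by rewrite w_eq1 eqxx in w1.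
Qed.
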